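(* Let $(\mathbf{y}^\star,\mathbf{w}^\star,\boldsymbol{\rho}^\star)$ be an equilibrium matching pattern (under a perfectly competitive market) of the crowdsourced delivery system. Then $\mathbf{y}^\star$ maximizes the social surplus, i.e. $\mathbf{y}^\star$ is an optimal solution of the system optimal matching problem $$\max_{\mathbf{y}}\ \sum_{a\in\mathcal{A}}\sum_{rs\in\mathcal{T}}(\overline{c}_{rs}-c^{rs}_a)\,y^{rs}_a$$ subject to $\sum_{rs\in\mathcal{T}}y^{rs}_a=1$ for all $a\in\mathcal{A}$, $\ \sum_{a\in\mathcal{A}}y^{rs}_a\le n_{rs}$ for all $rs\in\mathcal{T}$, and $y^{rs}_a\in\{0,1\}$ for all $a\in\mathcal{A}$, $rs\in\mathcal{T}$.
   Context: $\mathcal{A}$ is a finite set of drivers and $\mathcal{T}$ a finite set of pickup-delivery location pairs $rs=(r,s)$. For each $rs\in\mathcal{T}$, $n_{rs}$ is the (integer) number of delivery tasks for $(r,s)$ and $\overline{c}_{rs}\in\mathbb{R}$ is the cost of having one such task performed by a dedicated vehicle. For $a\in\mathcal{A}$, $rs\in\mathcal{T}$, $c^{rs}_a\in\mathbb{R}$ is the disutility of driver $a$ for performing a task for $(r,s)$. A matching pattern is $\mathbf{y}=[y^{rs}_a]$ with $y^{rs}_a\in\{0,1\}$, where $y^{rs}_a=1$ iff driver $a$ is matched with a task for $(r,s)$. The vector $\mathbf{w}=[w_{rs}]_{rs\in\mathcal{T}}$ gives the rewards for tasks, with $w_{rs}\le\overline{c}_{rs}$ (the dedicated-vehicle cost is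 an upper bound on the reward), and $\boldsymbol{\rho}=[\rho_a]_{a\in\mathcal{A}}$ is a real vector of driver utilities. An equilibrium matching pattern under a perfectly competitive market is a tuple $(\mathbf{y}^\star,\mathbf{w}^\star,\boldsymbol{\rho}^\star)$ satisfying: (Utility maximization) for all $a\in\mathcal{A}$, $rs\in\mathcal{T}$: $w^\star_{rs}-c^{rs}_a=\rho^\star_a$ if $y^{rs\star}_a>0$, and $w^\star_{rs}-c^{rs}_a\le\rho^\star_a$ if $y^{rs\star}_a=0$; (Supply and demand) for all $rs\in\mathcal{T}$: $\sum_{a\in\mathcal{A}}y^{rs\star}_a=n_{rs}$ if $\overline{c}_{rs}-w^\star_{rs}>0$, and $\sum_{a\in\mathcal{A}}y^{rs\star}_a\le n_{rs}$ if $\overline{c}_{rs}-w^\star_{rs}=0$; (Conservation) for all $a\in\mathcal{A}$: $\sum_{rs\in\mathcal{T}}y^{rs\star}_a=1$. *)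

(* Defs.v *)
From mathcomp Require Import all_boot all_order all_algebra.
From mathcomp Require Import reals.

Set Implicit Arguments.
Unset Strict Implicit.
Unset Printing Implicit Defensive.

Import Order.TTheory GRing.Theory Num.Theory.
Local Open Scope ring_scope.

(* y a rs is the 0/1 decision variable "driver a is matched with a task for
   the pair rs"; the coercions bool >-> nat and %:R make it a number.  *)
Definition matching (A T : finType) := A -> T -> bool.

Definition utility_maximization (R : realType) (A T : finType)
    (c : A -> T -> R) (y : matching A T) (w : T -> R) (rho : A -> R) : Prop :=
  forall (a : A) (rs : T),
    ((0 < y a rs)%N -> w rs - c a rs = rho a) /\
    (y a rs = 0%N :> nat -> w rs - c a rs <= rho a).

Definition supply_demand (R : realType) (A T : finType) (n : T -> nat)
    (cbar : T -> R) (y : matching A T) (w : T -> R) : Prop :=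
  forall rs : T,
    (0 < cbar rs - w rs -> (\sum_(a : A) y a rs = n rs)%N) /\
    (cbar rs - w rs = 0 -> (\sum_(a : A) y a rs <= n rs)%N).

Definition conservation (A T : finType) (y : matching A T) : Prop :=
  forall a : A, (\sum_(rs : T) y a rs = 1)%N.

Definition equilibrium (R : realType) (A T : finType) (n : T -> nat)
    (cbar : T -> R) (c : A -> T -> R)
    (y : matching A T) (w : T -> R) (rho : A -> R) : Prop :=
  [/\ utility_maximization c y w rho,
      supply_demand n cbar y w
    & conservation y].

Definition social_surplus (R : realType) (A T : finType)
    (cbar : T -> R) (c : A -> T -> R) (y : matching A T) : R :=
  \sum_(a : A) \sum_(rs : T) (cbar rs - c a rs) * (y a rs)%:R.

Definition feasible (A T : finType) (n : T -> nat) (y : matching A T) : Prop :=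
  (forall a : A, (\sum_(rs : T) y a rs = 1)%N) /\
  (forall rs : T, (\sum_(a : A) y a rs <= n rs)%N).

Definition system_optimal (R : realType) (A T : finType) (n : T -> nat)
    (cbar : T -> R) (c : A -> T -> R) (y : matching A T) : Prop :=
  feasible n y /\
  forall y' : matching A T, feasible n y' ->
    social_surplus cbar c y' <= social_surplus cbar c y.

(* Main.v *)
Require Import Defs.
From mathcomp Require Import all_boot all_order all_algebra.
From mathcomp Require Import reals.

Import Order.TTheory GRing.Theory Num.Theory.
Local Open Scope ring_scope.

(** The argument is linear programming duality.  The utilities [rho] and the
    rents [cbar - w], which are nonnegative by the bound on the rewards, form
    a feasible solution of the dual of the relaxed matching problem, of value
    [dual_value].  Weak duality ([surplus_le_dual]) bounds the surplus of every
    feasible matching by this value, since utility maximization gives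
    [w rs - c a rs <= rho a] on all pairs.  The equilibrium conditions are also
    the complementary slackness conditions: matched pairs have
    [w rs - c a rs = rho a], and a pair [rs] whose demand is not exhausted has
    zero rent.  Hence the equilibrium matching attains the bound
    ([equilibrium_surplus]). *)

Definition dual_value {R : realType} {A T : finType} (n : T -> nat)
    (cbar w : T -> R) (rho : A -> R) : R :=
  \sum_(a : A) rho a + \sum_(rs : T) (cbar rs - w rs) * (n rs)%:R.

(** Rewards are transfers, so they may be added and subtracted: the surplus is
    the net income of the drivers plus the savings of the senders over
    dedicated vehicles. *)
Lemma surplus_split (R : realType) (A T : finType) (cbar w : T -> R)
    (c : A -> T -> R) (y : matching A T) :
  social_surplus cbar c y =
    \sum_(a : A) \sum_(rs : T) (w rs - c a rs) * (y a rs)%:R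
    + \sum_(rs : T) (cbar rs - w rs) * (\sum_(a : A) y a rs)%N%:R.
Proof.
under [X in _ = _ + X]eq_bigr => rs _ do rewrite natr_sum mulr_sumr.
rewrite [X in _ = _ + X]exchange_big -big_split; apply: eq_bigr => a _.
rewrite -big_split; apply: eq_bigr => rs _ /=.
by rewrite -mulrDl [X in _ = X * _]addrC addrA subrK.
Qed.

(** A driver performs exactly one task, so weighting a constant utility by the
    tasks performed gives that utility back. *)
Lemma sum_conserved (R : realType) (A T : finType) (y : matching A T)
    (rho : A -> R) :
  conservation y ->
  \sum_(a : A) \sum_(rs : T) rho a * (y a rs)%:R = \sum_(a : A) rho a.
Proof.
by move=> cons; apply: eq_bigr => a _; rewrite -mulr_sumr -natr_sum cons mulr1.
Qed.

Lemma surplus_le_dual (R : realType) (A T : finType) (n : T -> nat)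
    (cbar w : T -> R) (c : A -> T -> R) (rho : A -> R) (y : matching A T) :
  (forall rs, w rs <= cbar rs) ->
  (forall a rs, w rs - c a rs <= rho a) ->
  feasible n y -> social_surplus cbar c y <= dual_value n cbar w rho.
Proof.
move=> w_le rho_ge [cons cap].
rewrite (surplus_split _ _ _ _ w) /dual_value -(sum_conserved _ _ _ _ rho cons).
apply: lerD.
  by apply: ler_sum => a _; apply: ler_sum => rs _; rewrite ler_wpM2r.
by apply: ler_sum => rs _; rewrite ler_wpM2l ?subr_ge0 ?ler_nat.
Qed.

Lemma equilibrium_utility_ge (R : realType) (A T : finType)
    (c : A -> T -> R) (y : matching A T) (w : T -> R) (rho : A -> R) :
  utility_maximization c y w rho -> forall a rs, w rs - c a rs <= rho a.
Proof.
move=> util a rs; case: (util a rs).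
by case: (y a rs) => [/(_ isT) -> _|_ ->].
Qed.

(** The two cases of the supply and demand condition are exhaustive only when
    the rents are nonnegative. *)
Lemma equilibrium_feasible (R : realType) (A T : finType) (n : T -> nat)
    (cbar : T -> R) (c : A -> T -> R) (y : matching A T) (w : T -> R)
    (rho : A -> R) :
  (forall rs, w rs <= cbar rs) ->
  equilibrium n cbar c y w rho -> feasible n y.
Proof.
move=> w_le [_ supply cons]; split=> // rs.
have [sat cap] := supply rs.
have := w_le rs; rewrite -subr_ge0 le_eqVlt => /orP[/eqP/esym/cap //|/sat ->].
exact: leqnn.
Qed.

(** Complementary slackness turns both inequalities of weak duality into
    equalities, term by term. *)
Lemma equilibrium_surplus (R : realType) (A T : finType) (n : T -> nat)
    (cbar : T -> R) (c : A -> T -> R) (y : matching A T) (w : T -> R)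
    (rho : A -> R) :
  (forall rs, w rs <= cbar rs) ->
  equilibrium n cbar c y w rho ->
  social_surplus cbar c y = dual_value n cbar w rho.
Proof.
move=> w_le [util supply cons].
rewrite (surplus_split _ _ _ _ w) /dual_value -(sum_conserved _ _ _ _ rho cons).
congr (_ + _).
  apply: eq_bigr => a _; apply: eq_bigr => rs _.
  have [tight _] := util a rs.
  by case: (y a rs) tight => [/(_ isT) ->|_]; rewrite ?mulr0.
apply: eq_bigr => rs _; have [sat _] := supply rs.
have := w_le rs; rewrite -subr_ge0 le_eqVlt => /orP[/eqP <-|/sat -> //].
by rewrite !mul0r.
Qed.

Theorem proposition1 (R : realType) (A T : finType) (n : T -> nat)
    (cbar : T -> R) (c : A -> T -> R)
    (y : matching A T) (w : T -> R) (rho : A -> R)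
    (reward_bound : forall rs : T, w rs <= cbar rs)
    (equil : equilibrium n cbar c y w rho) :
  system_optimal n cbar c y.
Proof.
split; first exact: equilibrium_feasible reward_bound equil.
move=> y' feas; rewrite (equilibrium_surplus _ _ _ _ _ _ _ _ _ reward_bound equil).
apply: surplus_le_dual feas => //.
by case: equil => util _ _; apply: equilibrium_utility_ge util.
Qed.
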